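(* Let $\mathbf{s}=(s_1,s_2,\ldots)$ be a sequence of positive integers and $n\ge3$. If $s_n\ge s_{n-1}$, then $\mathbf{s}$ is $n$-contractible. Thus, if $\mathbf{s}$ is such that $(s_i)_{i=2}^{\infty}$ is nondecreasing, then $\mathbf{s}$ is contractible. In particular, nondecreasing sequences are contractible.
   Context: For a finite sequence $(s_1,\ldots,s_n)$ of positive integers, let $\mathbf{v}_i=(0,\ldots,0,s_i,s_{i+1},\ldots,s_n)\in\mathbb{R}^n$ (first $i-1$ coordinates zero) for $1\le i\le n$, and let $\Pi_n^{(\mathbf{s})}=\left\{\sum_{i=1}^n\alpha_i\mathbf{v}_i \mid 0\le\alpha_i<1\right\}$. Define $Q_n^{(\mathbf{s})}(x)=\sum_{\lambda\in\Pi_n^{(\mathbf{s})}\cap\mathbb{Z}^n}x^{\lambda_n}$. For an infinite sequence $\mathbf{s}$ of positive integers, $Q_n^{(\mathbf{s})}$ means $Q_n^{(s_1,\ldots,s_n)}$. For $n\ge 2$ put $$P_{n-1}^{(\mathbf{s})}(x)=\frac{Q_n^{(\mathbf{s})}(x)}{1+x+\cdots+x^{s_n-1}},$$ which is a polynomial. In this statement the coefficient sequence of a polynomial is the sequence of its nonzero coefficients, listed in order of exponent. For $n\ge 3$, $\mathbf{s}$ is $n$-contractible if the coefficient sequences of $Q_{n-1}^{(\mathbf{s})}(x)$ and $P_{n-1}^{(\mathbf{s})}(x)$ coincide. $\mathbf{s}$ is contractible if it is $n$-contractible for all $n\ge 3$. *)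

(* Defs.v *)
From mathcomp Require Import all_boot all_order all_algebra.
From mathcomp Require Import all_classical all_reals.

Set Implicit Arguments.
Unset Strict Implicit.
Unset Printing Implicit Defensive.

Import Order.TTheory GRing.Theory Num.Theory.

Local Open Scope classical_set_scope.
Local Open Scope ring_scope.

(** Finite sequences [(s_1, ..., s_n)] are functions on ['I_n], so that [s_i]
    is the value at the ordinal [i - 1]. *)

Definition cone_gen (R : realType) (n : nat) (s : 'I_n -> nat) (i : 'I_n) :
    'rV[R]_n :=
  \row_(j < n) (if (i <= j)%N then (s j)%:R else 0).

Definition parallelepiped (R : realType) (n : nat) (s : 'I_n -> nat) :
    set 'rV[R]_n :=
  [set x | exists a : 'I_n -> R,
     (forall i, 0 <= a i < 1) /\ x = \sum_(i < n) a i *: cone_gen R s i].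

Definition lattice_points (R : realType) (n : nat) (s : 'I_n -> nat) :
    set 'rV[int]_n :=
  [set l | parallelepiped s (map_mx (intr : int -> R) l)].

(** [l_n], with the junk value [0] in dimension [0]. *)
Definition last_coord (n : nat) : 'rV[int]_n -> int :=
  match n with
  | 0 => fun=> 0
  | _.+1 => fun l => l 0 ord_max
  end.

(** The sum is the finitely supported one: it would be [0] if the set of
    lattice points were infinite, but the parallelepiped is bounded.  The
    coordinates of its points are nonnegative, so the absolute value only turns
    the exponent into a natural number. *)
Definition Q_fin (R : realType) (n : nat) (s : 'I_n -> nat) : {poly rat} :=
  \sum_(l \in lattice_points R s) ('X^(`|last_coord l|%N) : {poly rat}).

(** Infinite sequences are indexed from [1], as [s 1, s 2, ...]; the value
    [s 0] is never used. *)
Definition Q (R : realType) (s : nat -> nat) (n : nat) : {poly rat} :=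
  Q_fin R (fun i : 'I_n => s i.+1).

(** [P R s m] is the quotient of [Q_(m+1)].  For positive [s] and [m >= 1] the
    division is exact: [l_(m+1)] ranges over [s_(m+1)] consecutive integers once
    the other coordinates are fixed. *)
Definition P (R : realType) (s : nat -> nat) (m : nat) : {poly rat} :=
  Q R s m.+1 %/ \sum_(i < s m.+1) 'X^i.

Definition coef_seq (p : {poly rat}) : seq rat := [seq c <- p | c != 0].

(** Only used for [n >= 3]. *)
Definition n_contractible (R : realType) (s : nat -> nat) (n : nat) : Prop :=
  coef_seq (Q R s n.-1) = coef_seq (P R s n.-1).

Definition contractible (R : realType) (s : nat -> nat) : Prop :=
  forall n : nat, (3 <= n)%N -> n_contractible R s n.

Definition nondecreasing_from (k : nat) (s : nat -> nat) : Prop :=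
  forall i j : nat, (k <= i)%N -> (i <= j)%N -> (s i <= s j)%N.

(* Main.v *)
Require Import Defs.
From mathcomp Require Import all_boot all_order all_algebra.
From mathcomp Require Import all_classical all_reals.
From mathcomp Require Import zify.

(** A point [l] lies in the parallelepiped iff each increment
    [l_(j+1) / s_(j+1) - l_j / s_j] lies in [[0, 1)].  Once [l_1, ..., l_(n-1)]
    are fixed, [l_n] therefore runs over the [s_n] consecutive integers starting
    at [ceil (s_n * l_(n-1) / s_(n-1))], so that [P_(n-1)] is obtained from
    [Q_(n-1)] by replacing every exponent [k] by [ceil (s_n * k / s_(n-1))].
    When [s_n >= s_(n-1)] this map is strictly increasing, hence it preserves the
    sequence of nonzero coefficients. *)

Set Implicit Arguments.
Unset Strict Implicit.
Unset Printing Implicit Defensive.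

Import Order.TTheory GRing.Theory Num.Theory.

Local Open Scope classical_set_scope.
Local Open Scope ring_scope.

(** * Coefficient sequences under a change of exponents *)

Lemma coef_seqE (p : {poly rat}) :
  coef_seq p = [seq p`_i | i <- iota 0 (size p) & p`_i != 0].
Proof.
rewrite /coef_seq -{1}(mkseq_nth 0 p) /mkseq filter_map.
by congr map; apply: eq_filter.
Qed.

Lemma mem_support_iota (p : {poly rat}) (i : nat) :
  (i \in [seq j <- iota 0 (size p) | p`_j != 0]) = (p`_i != 0).
Proof.
rewrite mem_filter mem_iota /= add0n; case: ltnP => [|/(nth_default 0) ->].
  by rewrite andbT.
by rewrite eqxx.
Qed.

(** The support of [q] is the image under [f] of the support of [p], and an increasing [f] lists it
    in the same order. *)
Lemma coef_seq_reexponent (p q : {poly rat}) (f : nat -> nat) :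
    {homo f : i j / (i < j)%N} -> (forall i, q`_(f i) = p`_i) ->
    (forall j, q`_j != 0 -> exists i, j = f i) ->
  coef_seq p = coef_seq q.
Proof.
move=> f_mono qf q_im; rewrite !coef_seqE.
set sp := [seq i <- iota 0 (size p) | p`_i != 0].
suff -> : [seq j <- iota 0 (size q) | q`_j != 0] = map f sp.
  by rewrite -map_comp; apply: eq_map => i /=; rewrite qf.
(* Strictly increasing lists with the same members are equal. *)
apply: (irr_sorted_eq ltn_trans ltnn).
- by rewrite sorted_filter ?iota_ltn_sorted //; apply: ltn_trans.
- apply: (homo_sorted f_mono).
  by rewrite sorted_filter ?iota_ltn_sorted //; apply: ltn_trans.
- move=> j; rewrite mem_support_iota; apply/idP/mapP => [qj|[i + ->]].
    have [i ij] := q_im j qj; exists i => //.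
    by rewrite mem_support_iota -qf -ij.
  by rewrite mem_support_iota qf.
Qed.

Lemma coef_sumXn (T : Type) (r : seq T) (g : T -> nat) (i : nat) :
  (\sum_(x <- r) ('X^(g x) : {poly rat}))`_i = (count (fun x => g x == i) r)%:R.
Proof.
rewrite coef_sum; elim: r => [|x r IHr]; first by rewrite big_nil.
by rewrite big_cons IHr coefXn /= natrD eq_sym.
Qed.

(** Since [f] is injective, monomials merge on the right exactly when they merge on the left. *)
Lemma coef_seq_sumXn (T : Type) (r : seq T) (g : T -> nat) (f : nat -> nat) :
    {homo f : i j / (i < j)%N} ->
  coef_seq (\sum_(x <- r) 'X^(g x)) = coef_seq (\sum_(x <- r) 'X^(f (g x))).
Proof.
move=> f_mono; apply: (coef_seq_reexponent f_mono) => [i|j].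
  rewrite !coef_sumXn; congr _%:R; apply: eq_count => x /=.
  have f_le : {mono f : m n / (m <= n)%N} by apply: leq_mono.
  by rewrite !eqn_leq !f_le.
rewrite coef_sumXn pnatr_eq0 -lt0n -has_count.
by elim: r => //= x r IHr /orP[/eqP <-|//]; exists (g x).
Qed.

(** The ceiling of [k * a / b] for positive [b]. *)
Definition ceil_scale (a b k : nat) : nat := (k * a + b.-1) %/ b.

Lemma leq_ceil_scale (a b k z : nat) : (0 < b)%N ->
  (ceil_scale a b k <= z)%N = (k * a <= z * b)%N.
Proof. by move=> b0; rewrite /ceil_scale -ltnS ltn_divLR // mulSn; lia. Qed.

(** Raising [k] by one adds [a >= b] to the numerator, so the quotient by [b] grows by at least
    one. *)
Lemma ceil_scale_homo (a b : nat) : (0 < b)%N -> (b <= a)%N ->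
  {homo ceil_scale a b : i j / (i < j)%N}.
Proof.
move=> b0 ba i j ij; rewrite /ceil_scale leq_divRL // mulSn.
have := leq_divM (i * a + b.-1) b; nia.
Qed.

(** * Splitting off the last coordinate *)

Definition row_rcons (n : nat) (l : 'rV[int]_n) (z : int) : 'rV[int]_n.+1 :=
  \row_j (if unlift ord_max j is Some k then l 0 k else z).

Definition row_belast (n : nat) (l : 'rV[int]_n.+1) : 'rV[int]_n :=
  \row_j l 0 (lift ord_max j).

Lemma row_rconsK (n : nat) (l : 'rV[int]_n) (z : int) :
  row_belast (row_rcons l z) = l.
Proof. by apply/rowP => j; rewrite !mxE liftK. Qed.

Lemma last_coord_row_rcons (n : nat) (l : 'rV[int]_n) (z : int) :
  last_coord (row_rcons l z) = z.
Proof. by rewrite /= mxE unlift_none. Qed.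

Lemma row_belastK (n : nat) (l : 'rV[int]_n.+1) :
  row_rcons (row_belast l) (last_coord l) = l.
Proof.
by apply/rowP => j; rewrite !mxE; case: unliftP => [k ->|->]; rewrite ?mxE.
Qed.

(** * Recursive description of the lattice points *)

Section Lattice.

Variables (R : realType) (s : nat -> nat).
Hypothesis s_gt0 : forall i, (0 < s i)%N.

Let dim_seq n : 'I_n -> nat := fun i => s i.+1.

(** Dividing each coordinate by its [s j.+1] leaves a partial sum of [a], so successive differences
    recover the coefficients. *)
Lemma cone_combination (n : nat) (a : 'I_n -> R) (j : 'I_n) :
  (\sum_(i < n) a i *: cone_gen R (@dim_seq n) i) 0 j =
  (s j.+1)%:R * \sum_(i < n | (i <= j)%N) a i.
Proof.
rewrite summxE mulr_sumr [RHS]big_mkcond /=; apply: eq_bigr => i _.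
by rewrite !mxE; case: ifP => _; rewrite ?mulr0 // mulrC.
Qed.

Lemma last_coord_cone (n : nat) (l : 'rV[int]_n) (a : 'I_n -> R) :
    map_mx intr l = \sum_(i < n) a i *: cone_gen R (@dim_seq n) i ->
  (last_coord l)%:~R = (s n)%:R * \sum_(i < n) a i.
Proof.
(* In dimension 0 the default last coordinate and the empty sum are both 0. *)
case: n l a => [|n] l a la; first by rewrite big_ord0 mulr0.
transitivity (map_mx (intr : int -> R) l 0 ord_max); first by rewrite mxE.
rewrite la cone_combination; congr (_ * _).
by apply: eq_bigl => i; rewrite /= -ltnS ltn_ord.
Qed.

(** The displayed increment is the coefficient of the last generator, and the remaining coefficients
    are those of [row_belast l]. For [n = 0] the subtracted term is 0. *)
Lemma lattice_pointsS (n : nat) (l : 'rV[int]_n.+1) :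
  lattice_points R (@dim_seq n.+1) l <->
  lattice_points R (@dim_seq n) (row_belast l) /\
  0 <= ((last_coord l)%:~R / (s n.+1)%:R
        - (last_coord (row_belast l))%:~R / (s n)%:R : R) < 1.
Proof.
have s_neq0 i : (s i)%:R != 0 :> R by rewrite pnatr_eq0 -lt0n.
have belast_cone (a : 'I_n.+1 -> R) (j : 'I_n) :
    (\sum_(i < n) a (lift ord_max i) *: cone_gen R (@dim_seq n) i) 0 j =
    (\sum_(i < n.+1) a i *: cone_gen R (@dim_seq n.+1) i) 0 (lift ord_max j).
  rewrite !cone_combination lift_max; congr (_ * _).
  rewrite [RHS]big_mkcond big_ord_recr /= leqNgt ltn_ord addr0 -big_mkcond /=.
  apply: eq_bigr => i _; congr a; apply: val_inj; exact: lift_max.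
have sum_lift (a : 'I_n.+1 -> R) :
    \sum_i a i = \sum_i a (lift ord_max i) + a ord_max.
  rewrite big_ord_recr /=; congr (_ + _); apply: eq_bigr => i _; congr a.
  by apply: val_inj; rewrite [RHS]lift_max.
split=> [[a [a01 la]]|[[a [a01 la]] d01]].
  have lb : map_mx intr (row_belast l) =
      \sum_(i < n) a (lift ord_max i) *: cone_gen R (@dim_seq n) i.
    by apply/rowP => j; rewrite belast_cone -la !mxE.
  split; first by exists (fun i => a (lift ord_max i)).
  rewrite (last_coord_cone la) (last_coord_cone lb) ![_%:R * _]mulrC !mulfK //.
  by rewrite sum_lift addrAC subrr add0r.
set d := _ - _ in d01.
(* The coefficients of the truncated row, extended by the increment [d]. *)
pose b j := if unlift ord_max j is Some k then a k else d.
exists b; split=> [i|]; first by rewrite /b; case: unliftP.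
apply/rowP => j; case: (unliftP ord_max j) => [k ->|->].
  rewrite -belast_cone.
  have -> : \sum_(i < n) b (lift ord_max i) *: cone_gen R (@dim_seq n) i =
            map_mx intr (row_belast l).
    by rewrite la; apply: eq_bigr => i _; rewrite /b liftK.
  by rewrite !mxE.
rewrite cone_combination mxE.
have -> : \sum_(i < n.+1 | (i <= @ord_max n)%N) b i = \sum_i b i.
  by apply: eq_bigl => i; rewrite /= -ltnS ltn_ord.
rewrite sum_lift (eq_bigr a) => [|i _]; last by rewrite /b liftK.
rewrite /b unlift_none /d (last_coord_cone la).
by rewrite [(s n)%:R * _]mulrC mulfK // addrC subrK mulrC divfK.
Qed.

Lemma last_coord_ge0 (n : nat) (l : 'rV[int]_n) :
  lattice_points R (@dim_seq n) l -> 0 <= last_coord l.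
Proof.
case=> a [a01 la]; rewrite -(ler0z R) (last_coord_cone la) mulr_ge0 //.
by apply: sumr_ge0 => i _; case/andP: (a01 i).
Qed.

(** After scaling by [a], the lower bound says that [z] is at least [y * a / b], and the upper bound
    that [z - a] is below it; integers compare in the same way with its ceiling. *)
Lemma increment_ceil_scale (a b y z : nat) : (0 < a)%N -> (0 < b)%N ->
  (0 <= (z%:R / a%:R - y%:R / b%:R : R) < 1) =
  (ceil_scale a b y <= z < ceil_scale a b y + a)%N.
Proof.
move=> a0 b0; have aR : 0 < a%:R :> R by rewrite ltr0n.
have bR : 0 < b%:R :> R by rewrite ltr0n.
rewrite subr_ge0 ltrBlDr ler_pdivlMr // mulrAC ler_pdivrMr //.
rewrite ltr_pdivrMr // mulrDl mul1r mulrAC -(ltr_pM2r bR) mulrDl divfK ?gt_eqF //.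
rewrite -!natrM -natrD ler_nat ltr_nat leq_ceil_scale //; congr andb.
rewrite ltnNge [RHS]ltnNge [(_ + a)%N]addnC; congr negb.
(* Truncated subtraction [z - a] is faithful only for [a <= z]; otherwise both upper bounds hold
   automatically. *)
have [az|za] := leqP a z.
  by rewrite -[RHS]leq_subRL // leq_ceil_scale // mulnBl
     leq_subRL // leq_mul2r az orbT.
have zb : (z * b < a * b)%N by rewrite ltn_pmul2r.
by apply/idP/idP; lia.
Qed.

(** An explicit list, which makes the finitely supported sum an ordinary one. At [m = 0] the ceiling
    is 0 because [s 0] is positive, so the first coordinate starts at 0. *)
Fixpoint lattice_enum (n : nat) : seq 'rV[int]_n :=
  if n is m.+1 then
    [seq row_rcons l (ceil_scale (s m.+1) (s m) `|last_coord l| + t)%N%:Z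
       | l <- lattice_enum m, t <- iota 0 (s m.+1)]
  else [:: 0].

Lemma lattice_enum_uniq (n : nat) : uniq (lattice_enum n).
Proof.
elim: n => [//|n IHn] /=; apply: allpairs_uniq => //; first exact: iota_uniq.
move=> [l t] [l' t'] _ _ /= e.
have ll' : l = l' by have := congr1 (@row_belast _) e; rewrite !row_rconsK.
move: e; rewrite -{}ll' => /(congr1 (@last_coord _)).
by rewrite !last_coord_row_rcons => -[/addnI ->].
Qed.

Lemma lattice_enumP (n : nat) (l : 'rV[int]_n) :
  lattice_points R (@dim_seq n) l <-> l \in lattice_enum n.
Proof.
elim: n l => [|n IHn] l.
  rewrite (thinmx0 l) inE eqxx; split=> // _.
  by exists (fun=> 0); split=> [[]//|]; rewrite big_ord0; apply: thinmx0.
split=> [ll|].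
  (* Nonnegativity identifies the integer coordinates with their absolute values, as the criterion
     over [nat] requires. *)
  have z0 := last_coord_ge0 ll.
  case/lattice_pointsS: ll => lb; have y0 := last_coord_ge0 lb.
  rewrite -(gez0_abs z0) -(gez0_abs y0) increment_ceil_scale // => /andP[cz zc].
  apply/allpairsP.
  exists (row_belast l, (`|last_coord l| -
     ceil_scale (s n.+1) (s n) `|last_coord (row_belast l)|)%N) => /=.
  split; [exact/IHn | by rewrite mem_iota add0n ltn_subLR |].
  by rewrite subnKC // gez0_abs // row_belastK.
case/allpairsP => -[l' t] /= [/IHn ll']; rewrite mem_iota /= add0n => ts ->.
apply/lattice_pointsS; rewrite row_rconsK; split=> //.
rewrite last_coord_row_rcons -{2 4}(gez0_abs (last_coord_ge0 ll')).
by rewrite increment_ceil_scale // leq_addr ltn_add2l.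
Qed.

(** * [Q] and [P] as sums over one list *)

Lemma Q_enum (n : nat) :
  Q R s n = \sum_(l <- lattice_enum n) 'X^(`|last_coord l|).
Proof.
rewrite /Q /Q_fin (_ : lattice_points _ _ = [set` lattice_enum n]).
  by rewrite -fsbig_seq ?lattice_enum_uniq.
by apply/seteqP; split=> l /= /lattice_enumP.
Qed.

(** The points of dimension [n.+1] above a given [l] contribute one monomial times the full divisor,
    so the division is exact term by term. *)
Lemma P_enum (n : nat) :
  P R s n =
  \sum_(l <- lattice_enum n) 'X^(ceil_scale (s n.+1) (s n) `|last_coord l|).
Proof.
rewrite /P Q_enum /=; set g := \sum_(i < _) _.
(* The constant coefficient counts the index 0, which occurs since [s n.+1] is positive. *)
have g0 : g != 0.
  apply/eqP => /(congr1 (fun p : {poly rat} => p`_0)).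
  rewrite /g -(big_mkord xpredT (fun i => 'X^i)) coef_sumXn coef0 => /eqP.
  rewrite pnatr_eq0 -leqn0 leqNgt -has_count => /hasP[].
  by exists 0%N; rewrite // mem_index_iota s_gt0.
rewrite big_allpairs_dep /=.
rewrite -[RHS](mulpK _ g0); congr (_ %/ _); rewrite mulr_suml.
apply: eq_bigr => l _; rewrite /g -(big_mkord xpredT (fun i => 'X^i)) mulr_sumr.
rewrite /index_iota subn0; apply: eq_bigr => t _.
by rewrite mxE unlift_none absz_nat exprD.
Qed.

Lemma n_contractible_leq (n : nat) :
  (s n.-1 <= s n)%N -> (0 < n)%N -> n_contractible R s n.
Proof.
case: n => //= n sn _; rewrite /n_contractible Q_enum P_enum.
exact/coef_seq_sumXn/ceil_scale_homo.
Qed.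

End Lattice.

Theorem proposition5p4 (R : realType) (s : nat -> nat)
    (s_gt0 : forall i : nat, (1 <= i)%N -> (0 < s i)%N) :
  [/\ forall n : nat, (3 <= n)%N -> (s n.-1 <= s n)%N -> n_contractible R s n,
      nondecreasing_from 2 s -> contractible R s
    & nondecreasing_from 1 s -> contractible R s].
Proof.
have step n : (3 <= n)%N -> (s n.-1 <= s n)%N -> n_contractible R s n.
  case: n => [|[|[|n]]] // _ sn.
  (* [s 0] is irrelevant but may vanish. *)
  pose t i := if i is j.+1 then s j.+1 else 1%N.
  have t_gt0 i : (0 < t i)%N by case: i => // i; apply: s_gt0.
  (* Only values at successors enter here, where [t] reduces to [s], so the two statements are
     convertible. *)
  exact: (@n_contractible_leq R t t_gt0 n.+3).
by split=> // s_incr n n3; apply: step => //; apply: s_incr; lia.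
Qed.
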